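(* Let $F\in\overline{\mathcal{F}}_d$ be a normalized set function. Then every minimal decomposition $(G,H)\in\mathcal{D}(F)$ of $F$ is a vertex of the polyhedron $\mathcal{D}(F)$.
   Context: Let $[d]=\{1,\dots,d\}$ and let $\mathcal{F}_d$ be the vector space of set functions $F\colon2^{[d]}\to\mathbb{R}$. $F$ is submodular if $F(A)+F(B)\ge F(A\cup B)+F(A\cap B)$ for all $A,B\subseteq[d]$, and modular if equality always holds. Let $\mathcal{MOD}_d\subseteq\mathcal{F}_d$ be the subspace of modular functions, $\overline{\mathcal{F}}_d=\mathcal{F}_d/\mathcal{MOD}_d$, and $\overline{\mathcal{SM}}_d\subseteq\overline{\mathcal{F}}_d$ the cone of classes of submodular functions. Since constants are modular, each class may be represented by a normalized function, i.e. one with $F(\emptyset)=0$, and all set functions are taken normalized. The set of decompositions of $F\in\overline{\mathcal{F}}_d$ is $\mathcal{D}(F)=\{(G,H)\in\overline{\mathcal{SM}}_d\times\overline{\mathcal{SM}}_d\mid F=G-H\}$, a polyhedron in $\overline{\mathcal{F}}_d\times\overline{\mathcal{F}}_d$. For a normalized submodular function $G$, its base polytope is $B(G)=\{x\in\mathbb{R}^d\mid\sum_{i\in S}x_i\le G(S)\ \forall S\subset[d],\ \sum_{i\in[d]}x_i=G([d])\}$; adding a normalized modular function to $G$ translates $B(G)$, so the number of vertices of $B(G)$ depends only on the class of $G$. A decomposition $(G,H)\in\mathcal{D}(F)$ is minimal if there is no other $(G',H')\in\mathcal{D}(F)$ such that $B(G')$ has at most as many vertices as $B(G)$, $B(H')$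 has at most as many vertices as $B(H)$, and one of the two has strictly fewer vertices. *)

(* Defs.v *)
From HB Require Import structures.
From mathcomp Require Import all_boot all_order all_algebra.
From mathcomp Require Import generic_quotient ring_quotient.
From mathcomp Require Import boolp classical_sets cardinality reals.

Set Implicit Arguments.
Unset Strict Implicit.
Unset Printing Implicit Defensive.

Import Order.TTheory GRing.Theory Num.Theory.
Local Open Scope classical_set_scope.
Local Open Scope quotient_scope.
Local Open Scope ring_scope.
Local Open Scope card_scope.

Section Faces.
Variables (R : realType) (V : lmodType R).

Definition is_face (P Q : set V) : Prop :=
  exists (c : {scalar V}) (c0 : R),
    (forall x, P x -> c x <= c0) /\ Q = [set x | P x /\ c x = c0].

(* A vertex is a face of dimension 0, i.e. a face reduced to a point. *)
Definition is_vertex (P : set V) (v : V) : Prop := is_face P [set v].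

Definition vertices (P : set V) : set V := [set v | is_vertex P v].

End Faces.

(* {0, ..., d-1} plays the role of [d].  The codomain is R^o (that is, R as a
   module over itself) so that set functions form an lmodType R. *)
Definition setfun (R : realType) (d : nat) := {ffun {set 'I_d} -> R^o}.

Section SetFunctions.
Variables (R : realType) (d : nat).
Implicit Types F G M : setfun R d.

Definition submodular F : bool :=
  [forall A : {set 'I_d}, forall B : {set 'I_d},
     F (A :|: B) + F (A :&: B) <= F A + F B].

Definition modular : {pred setfun R d} := fun F =>
  [forall A : {set 'I_d}, forall B : {set 'I_d},
     F A + F B == F (A :|: B) + F (A :&: B)].

Lemma modularP F :
  reflect (forall A B : {set 'I_d}, F A + F B = F (A :|: B) + F (A :&: B))
          (F \in modular).
Proof.
apply: (iffP forallP) => [h A B|h A]; first by apply/eqP; have /forallP := h A.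
by apply/forallP => B; apply/eqP.
Qed.

Lemma modular_zmod_closed : zmod_closed modular.
Proof.
split; first by apply/modularP => A B; rewrite !ffunE.
move=> F G /modularP hF /modularP hG; apply/modularP => A B.
by rewrite !ffunE addrACA hF -opprD hG opprD addrACA.
Qed.

HB.instance Definition _ :=
  GRing.isZmodClosed.Build (setfun R d) modular modular_zmod_closed.

Lemma modularZ (a : R) F : F \in modular -> a *: F \in modular.
Proof.
by move=> /modularP hF; apply/modularP => A B; rewrite !ffunE -!scalerDr hF.
Qed.

Definition normalized F : Prop := F finset.set0 = 0.

Definition base_polytope G : set 'rV[R]_d :=
  [set x | (forall S : {set 'I_d}, \sum_(i in S) x 0 i <= G S) /\
           \sum_i x 0 i = G [set: 'I_d]%SET].

End SetFunctions.

(* The quotient of the space of set functions by the modular ones; the library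
   provides its additive group structure only. *)
Definition setfun_quot (R : realType) (d : nat) := Quotient.quot (@modular R d).

Section Classes.
Variables (R : realType) (d : nat).
Local Notation Fbar := (setfun_quot R d).
Implicit Types (F G : setfun R d) (x y : Fbar).

HB.instance Definition _ := GRing.Zmodule.on Fbar.
HB.instance Definition _ := EqQuotient.on Fbar.

Definition cls F : Fbar := \pi_Fbar F.

Lemma cls_eq F G : cls F = cls G <-> F - G \in @modular R d.
Proof. by rewrite Quotient.idealrBE; split=> [/eqP|/eqP]. Qed.

Lemma clsD F G : cls (F + G) = cls F + cls G.
Proof. exact: (@Quotient.pi_add _ (@modular R d)). Qed.

Lemma cls_repr x : cls (repr x) = x.
Proof. exact: reprK. Qed.

Definition quot_scale (a : R) x : Fbar := cls (a *: repr x).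

Lemma cls_scale (a : R) F : cls (a *: F) = quot_scale a (cls F).
Proof.
apply/cls_eq; rewrite -scalerBr; apply: modularZ.
by apply/cls_eq; rewrite cls_repr.
Qed.

Lemma quot_scaleA a b x : quot_scale a (quot_scale b x) = quot_scale (a * b) x.
Proof. by rewrite -[x]cls_repr -!cls_scale scalerA. Qed.

Lemma quot_scale1 : left_id 1 quot_scale.
Proof. by move=> x; rewrite -[x]cls_repr -cls_scale scale1r. Qed.

Lemma quot_scaleDr : right_distributive quot_scale +%R.
Proof.
move=> a x y; rewrite -[x]cls_repr -[y]cls_repr.
by rewrite -clsD -!cls_scale scalerDr clsD.
Qed.

Lemma quot_scaleDl x : {morph quot_scale^~ x : a b / a + b}.
Proof.
by move=> a b; rewrite -[x]cls_repr -!cls_scale scalerDl clsD.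
Qed.

HB.instance Definition _ := GRing.Zmodule_isLmodule.Build R Fbar
  quot_scaleA quot_scale1 quot_scaleDr quot_scaleDl.

Definition submod_cone : set Fbar := @cls @` [set F | submodular F].

Definition decompositions (f : Fbar) : set (Fbar * Fbar)%type :=
  [set gh | [/\ submod_cone gh.1, submod_cone gh.2 & f = gh.1 - gh.2]].

Definition norm_repr x : setfun R d :=
  [ffun A => repr x A - repr x finset.set0].

Lemma norm_repr_normalized x : normalized (norm_repr x).
Proof. by rewrite /normalized ffunE subrr. Qed.

Lemma cls_norm_repr x : cls (norm_repr x) = x.
Proof.
rewrite -[RHS]cls_repr; apply/cls_eq/modularP => A B.
have E S : (norm_repr x - repr x) S = - repr x finset.set0.
  by rewrite 3!ffunE addrAC subrr add0r.
by rewrite !E.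
Qed.

(* The vertices of the base polytope of a class; up to the equipotence proved
   in class_vertices_wd, they do not depend on the normalized representative. *)
Definition class_vertices x : set 'rV[R]_d :=
  vertices (base_polytope (norm_repr x)).

Lemma modular_sum F : normalized F -> F \in @modular R d ->
  forall S : {set 'I_d}, F S = \sum_(i in S) F [set i]%SET.
Proof.
move=> F0 /modularP hF S.
have [n] := ubnP #|S|; elim: n S => // n IH S; rewrite ltnS => Sn.
have [->|[i iS]] := finset.set_0Vmem S; first by rewrite big_set0.
rewrite (big_setD1 i iS) /= -IH; last by rewrite (leq_trans _ Sn) // (cardsD1 i S) iS.
have := hF [set i]%SET (S :\ i)%SET.
have -> : ([set i] :&: (S :\ i))%SET = finset.set0.
  by apply/setP => j; rewrite !inE; case: eqP.
by rewrite finset.setD1K // F0 addr0 => ->.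
Qed.

Lemma base_polytope_translate F G (t : 'rV[R]_d) :
  (forall S : {set 'I_d}, F S = G S + \sum_(i in S) t 0 i) ->
  forall x : 'rV[R]_d, base_polytope F (x + t) <-> base_polytope G x.
Proof.
move=> FG x.
have E (S : {set 'I_d}) :
    \sum_(i in S) (x + t) 0 i = \sum_(i in S) x 0 i + \sum_(i in S) t 0 i.
  by rewrite -big_split; apply: eq_bigr => i _; rewrite mxE.
have ET (y : 'rV[R]_d) : \sum_i y 0 i = \sum_(i in [set: 'I_d]%SET) y 0 i.
  by apply: eq_bigl => i; rewrite inE.
rewrite /base_polytope /= !ET E FG.
split=> -[h1 h2]; split.
- by move=> S; move: (h1 S); rewrite E FG lerD2r.
- exact: addIr h2.
- by move=> S; rewrite E FG lerD2r.
- by rewrite h2.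
Qed.

Lemma vertices_translate (P Q : set 'rV[R]_d) (t : 'rV[R]_d) :
  (forall x : 'rV[R]_d, P (x + t) <-> Q x) -> forall v, vertices Q v -> vertices P (v + t).
Proof.
move=> PQ v [c [c0 [le_c vE]]]; exists c, (c0 + c t); split.
  move=> x Px; rewrite -[x](subrK t) linearD lerD2r; apply: le_c.
  by apply/PQ; rewrite subrK.
apply/seteqP; split=> x /=.
  move=> ->; have [Qv <-] : [set x | Q x /\ c x = c0] v by rewrite -vE.
  by rewrite linearD; split=> //; apply/PQ.
move=> [Px cx]; apply/eqP; rewrite -subr_eq; apply/eqP.
have : [set x | Q x /\ c x = c0] (x - t).
  split; first by apply/PQ; rewrite subrK.
  by rewrite linearB cx /= addrK.
by rewrite -vE.
Qed.

Lemma class_vertices_wd F : normalized F ->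
  class_vertices (cls F) #= vertices (base_polytope F).
Proof.
move=> F0; set G := norm_repr (cls F).
suff le F1 F2 : normalized F1 -> normalized F2 -> cls F1 = cls F2 ->
    vertices (base_polytope F1) #<= vertices (base_polytope F2).
  by rewrite card_eq_le !le ?cls_norm_repr //; apply: norm_repr_normalized.
move=> n1 n2 /esym/cls_eq m21.
have n21 : normalized (F2 - F1) by rewrite /normalized !ffunE n1 n2 subrr.
pose t : 'rV[R]_d := \row_i (F2 - F1) [set i]%SET.
have tr := @base_polytope_translate F2 F1 t.
have sub : [set v + t | v in vertices (base_polytope F1)]
    `<=` vertices (base_polytope F2).
  move=> _ [v hv <-]; apply: vertices_translate hv => x; apply: tr => S.
  have := modular_sum n21 m21 S; rewrite ffunE => /eqP.
  rewrite !ffunE subr_eq addrC => /eqP ->; congr (_ + _).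
  by apply: eq_bigr => i _; rewrite mxE.
apply: card_le_trans (subset_card_le sub).
have := @inj_card_eq _ _ (vertices (base_polytope F1)) (fun v => v + t).
by rewrite card_eq_le => /(_ (in2W (@addIr _ t)))/andP[].
Qed.

(* Comparing numbers of vertices by cardinality presupposes no finiteness. *)
Definition fewer_eq_vertices x y : Prop :=
  class_vertices x #<= class_vertices y.

Definition fewer_vertices x y : Prop :=
  fewer_eq_vertices x y /\ ~ fewer_eq_vertices y x.

Definition minimal_decomposition (f : Fbar) (gh : Fbar * Fbar) : Prop :=
  decompositions f gh /\
  ~ exists gh' : Fbar * Fbar,
      [/\ decompositions f gh', gh' <> gh,
          fewer_eq_vertices gh'.1 gh.1,
          fewer_eq_vertices gh'.2 gh.2
        & fewer_vertices gh'.1 gh.1 \/ fewer_vertices gh'.2 gh.2].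

End Classes.

(* Main.v *)
Require Import Defs.
From HB Require Import structures.
From mathcomp Require Import all_boot all_order all_algebra.
From mathcomp Require Import boolp classical_sets cardinality reals.
From mathcomp Require Import finmap lra.

(** Write gap h A B = h A + h B - h (A :|: B) - h (A :&: B).  The gaps are linear
    functionals that vanish on modular functions; a class is submodular when all
    its gaps are nonnegative, and is zero when all of them vanish.  So the
    decomposition polyhedron is the set of pairs (G, H) with G - H = F cut out by
    the inequalities gap G >= 0 and gap H >= 0.

    The combinatorial core is that the tight pairs of G, those (A, B) with
    gap G A B = 0, control the vertices of the base polytope.  The vertices are
    the greedy vectors of the linear orders of the ground set (vertices_base),
    so their number is the number of classes of orders with a common greedy
    vector.  The sets that are tight at a given greedy vector form a lattice on
    which G is modular.  If every tight pair of G is tight for G', then G' is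
    modular on that lattice too, and hence two orders with the same greedy vector
    for G have the same one for G' (greedy_eq_transfer): B(G') has at most as many
    vertices as B(G).  If moreover some pair is tight for G' but not for G, there
    are two orders whose greedy vectors are merged by G' but not by G
    (gap_lost_greedy_eq), and B(G') has strictly fewer vertices.  In fan language,
    more tight pairs mean a coarser normal fan.

    Now let (G, H) be a minimal decomposition and let K be a direction along which
    the tight gaps of G and those of H stay zero.  If K were nonzero, some gap
    would vary along (G + t K, H + t K); moving to the first parameter t at which a
    positive gap reaches zero gives a decomposition that keeps all tight pairs and
    gains one, contradicting minimality (minimal_decomposition_rigid).  Finally,
    minus the sum of the gaps tight at (G, H) is a linear functional that is at
    most 0 on the polyhedron, and it is 0 at (G', H') exactly when the tight gaps of
    (G, H) vanish there too; taking K = G' - G = H' - H, rigidity shows that (G, H)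
    is its only maximizer. *)

Set Implicit Arguments.
Unset Strict Implicit.
Unset Printing Implicit Defensive.

Import Order.TTheory GRing.Theory Num.Theory.
Local Open Scope ring_scope.
Local Open Scope card_scope.

(** * Cardinals of images *)

Lemma finite_card_le_setD1N (T : choiceType) (X : set T) (x : T) :
  finite_set X -> X x -> ~ (X #<= X `\ x)%classic.
Proof.
move=> finX Xx.
have finXx : finite_set (X `\ x)%classic by exact: finite_setD.
have /finite_setP[n Xn] := finX; have /finite_setP[m Xm] := finXx.
rewrite (card_le_eql Xn) (card_le_eqr Xm) card_le_II => le_nm.
have := cardfsD1 x (fset_set X).
rewrite in_fset_set // mem_set //= (card_fset_set Xn).
have -> : (fset_set X `\ x)%fset = fset_set (X `\ x)%classic.
  by rewrite fset_setD // fset_set1.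
by rewrite (card_fset_set Xm) => nE; rewrite nE ltnn in le_nm.
Qed.

(** The inhabitant of [I] supplies the value of [phi] outside the image of [f]. *)
Lemma image_factor (I T U : Type) (P : set I) (f : I -> T) (g : I -> U) :
  (forall i j, P i -> P j -> f i = f j -> g i = g j) ->
  I -> exists phi : T -> U, forall i, P i -> phi (f i) = g i.
Proof.
move=> fg i0.
pose phi y := if pselect (exists2 i, P i & f i = y) is left ex
  then g (projT1 (cid2 ex)) else g i0.
exists phi => i Pi; rewrite /phi; case: pselect => [ex|[]]; last by exists i.
by case: (cid2 ex) => j Pj /= fji; apply: fg.
Qed.

Lemma card_image_le_of_factor (I T U : Type) (P : set I) (f : I -> T) (g : I -> U) :
  (forall i j, P i -> P j -> f i = f j -> g i = g j) ->
  (g @` P #<= f @` P)%classic.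
Proof.
move=> fg; have [->|/set0P[i0 Pi0]] := eqVneq P classical_sets.set0.
  by rewrite !image_set0 card_ge0.
have [phi phiE] := image_factor fg i0.
apply: (@card_le_trans _ _ _ (phi @` (f @` P))%classic); last exact: card_image_le.
apply: subset_card_le => _ [i Pi <-]; exists (f i); last exact: phiE.
by exists i.
Qed.

(** The factorization of [g] through [f] is onto but identifies [f i] with [f j],
    so it remains onto after deleting [f i]: the finite set [f @` P] would embed
    into itself minus a point. *)
Lemma card_image_ltN (I U : Type) (T : choiceType) (P : set I) (f : I -> T)
    (g : I -> U) (i j : I) :
  (forall i j, P i -> P j -> f i = f j -> g i = g j) ->
  finite_set (f @` P)%classic -> P i -> P j -> g i = g j -> f i <> f j ->
  ~ (f @` P #<= g @` P)%classic.
Proof.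
move=> fg finf Pi Pj gij fij le_fg.
have [phi phiE] := image_factor fg i.
apply: (finite_card_le_setD1N finf (x := f i)); first by exists i.
apply: (card_le_trans le_fg).
apply: (@card_le_trans _ _ _ (phi @` (f @` P `\ f i))%classic);
  last exact: card_image_le.
apply: subset_card_le => _ [k Pk <-].
have [fki|fki] := pselect (f k = f i).
  exists (f j); first by split=> [|/esym//]; exists j.
  by rewrite phiE // -gij; apply: fg.
by exists (f k); [split=> //; exists k | rewrite phiE].
Qed.

(** * Initial segments of a linear order *)

Section Greedy.
Variables (R : realType) (d : nat).
Implicit Types (h : {set 'I_d} -> R) (G : setfun R d) (x : 'rV[R]_d)
  (A B S : {set 'I_d}) (r : 'I_d -> nat).

Definition gap h A B : R := h A + h B - h (A :|: B) - h (A :&: B).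

Definition mass x S : R := \sum_(i in S) x 0 i.

Lemma gap_ge0 G A B : submodular G -> 0 <= gap G A B.
Proof.
by move=> /forallP /(_ A) /forallP /(_ B); rewrite /gap -addrA -opprD subr_ge0.
Qed.

Lemma gap_mass x A B : gap (mass x) A B = 0.
Proof.
rewrite /gap /mass [X in X + _ - _ - _](big_setID B) /=.
rewrite [X in _ - X - _](big_setID B) /=.
have -> : (A :|: B) :\: B = A :\: B by rewrite finset.setDUl finset.setDv finset.setU0.
have -> : (A :|: B) :&: B = B by apply/finset.setIidPr/finset.subsetUr.
lra.
Qed.

(** An injective rank function [r : 'I_d -> nat] stands for a linear order; allowing
    holes between ranks makes reordering (see [frontload]) a matter of arithmetic. *)
Definition initial r k : {set 'I_d} := [set i | (r i < k)%N].

Lemma initial0 r : initial r 0 = finset.set0.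
Proof. by apply/setP => i; rewrite !inE. Qed.

Lemma initial_full r : exists k, initial r k = finset.setT.
Proof.
exists (\max_i r i).+1; apply/setP => i; rewrite !inE ltnS.
exact: (leq_bigmax i).
Qed.

Lemma initialS r i : injective r -> initial r (r i).+1 = i |: initial r (r i).
Proof.
by move=> rI; apply/setP => j; rewrite !inE ltnS leq_eqVlt (inj_eq rI).
Qed.

Lemma initialS_or r k : injective r ->
  initial r k.+1 = initial r k \/ exists i, r i = k.
Proof.
move=> rI; case: (pickP (fun i => r i == k)) => [i /eqP rik|no].
  by right; exists i.
by left; apply/setP => j; rewrite !inE ltnS leq_eqVlt no.
Qed.

Lemma sum_initialS (f : 'I_d -> R) r i : injective r ->
  \sum_(j in initial r (r i).+1) f j = f i + \sum_(j in initial r (r i)) f j.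
Proof. by move=> rI; rewrite initialS // big_setU1 // !inE ltnn. Qed.

Lemma mass_initialS x r i : injective r ->
  mass x (initial r (r i).+1) = x 0 i + mass x (initial r (r i)).
Proof. exact: sum_initialS. Qed.

Lemma mass_initial_inj x y r : injective r ->
  (forall k, mass x (initial r k) = mass y (initial r k)) -> x = y.
Proof.
move=> rI xy; apply/rowP => i; have := xy (r i).+1.
by rewrite !mass_initialS // xy => /addIr.
Qed.

(** A function that vanishes on a maximal chain and is submodular on a lattice [L]
    containing it is nonnegative on [L].  Cut [A] by the chain: the set
    [A :&: initial r k.+1 :|: initial r k] lies between two consecutive members of
    the chain, hence belongs to it, and submodularity gives
    [h (A :&: initial r k) <= h (A :&: initial r k.+1)].  This one induction yields
    both the feasibility of greedy vectors ([L] everything) and, applied to [h]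
    and [- h], the extension of tightness from a chain to a lattice. *)
Lemma ge0_of_initial r h (L : {set 'I_d} -> Prop) : injective r ->
  (forall A B, L A -> L B -> L (A :|: B) /\ L (A :&: B)) ->
  (forall k, L (initial r k)) ->
  (forall A B, L A -> L B -> 0 <= gap h A B) ->
  (forall k, h (initial r k) = 0) ->
  forall A, L A -> 0 <= h A.
Proof.
move=> rI LUI Lr hL hr A LA.
suff hAr k : 0 <= h (A :&: initial r k).
  by have [k rk] := initial_full r; have := hAr k; rewrite rk finset.setIT.
elim: k => [|k IH]; first by rewrite initial0 finset.setI0 -(initial0 r) hr.
have LAk : L (A :&: initial r k.+1) by have [] := LUI _ _ LA (Lr k.+1).
have := hL _ _ LAk (Lr k); rewrite /gap -finset.setIA.
have -> : initial r k.+1 :&: initial r k = initial r k.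
  by apply/finset.setIidPr/fintype.subsetP => i; rewrite !inE => /ltnW.
have -> : h (A :&: initial r k.+1 :|: initial r k) = 0.
  have [rk|[i ri]] := initialS_or k rI.
    by rewrite rk (finset.setUidPr (finset.subsetIr _ _)) hr.
  case: (boolP (i \in A)) => iA.
    have -> : A :&: initial r k.+1 :|: initial r k = initial r k.+1; last by rewrite hr.
    apply/setP => j; rewrite -ri initialS // !inE.
    by case: eqP => [->|_] /=; [rewrite iA | case: (j \in A); rewrite /= ?orbb].
  have -> : A :&: initial r k.+1 :|: initial r k = initial r k; last by rewrite hr.
  apply/setP => j; rewrite -ri initialS // !inE.
  by case: eqP => [->|_] /=; [rewrite (negPf iA) | case: (j \in A); rewrite /= ?orbb].
rewrite hr; lra.
Qed.

(** * Greedy vectors *)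

Definition greedy G r : 'rV[R]_d :=
  \row_i (G (initial r (r i).+1) - G (initial r (r i))).

Lemma mass_greedy G r k : normalized G -> injective r ->
  mass (greedy G r) (initial r k) = G (initial r k).
Proof.
move=> G0 rI; elim: k => [|k IH]; first by rewrite initial0 /mass big_set0 G0.
have [->//|[i ri]] := initialS_or k rI.
by rewrite -ri mass_initialS // ri IH mxE ri subrK.
Qed.

Lemma gapB h1 h2 A B : gap (fun S => h1 S - h2 S) A B = gap h1 A B - gap h2 A B.
Proof. by rewrite /gap; lra. Qed.

Lemma base_polytopeP G x :
  base_polytope G x <->
  (forall S, mass x S <= G S) /\ mass x [set: 'I_d] = G [set: 'I_d].
Proof.
rewrite /base_polytope /=.
have -> // : \sum_i x 0 i = mass x [set: 'I_d].
by apply: eq_bigl => i; rewrite finset.in_setT.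
Qed.

Lemma greedy_base G r : submodular G -> normalized G -> injective r ->
  base_polytope G (greedy G r).
Proof.
move=> Gs G0 rI; apply/base_polytopeP; split=> [S|]; last first.
  by have [k <-] := initial_full r; rewrite mass_greedy.
rewrite -subr_ge0.
apply: (ge0_of_initial (h := fun S => G S - mass (greedy G r) S)
  (L := fun=> True) rI) => // [A B _ _|k].
  by rewrite gapB gap_mass subr0 gap_ge0.
by rewrite mass_greedy // subrr.
Qed.

(** The usual uncrossing argument: the mass is modular and bounded by [G], so
    submodularity of [G] leaves no slack at [A :|: B] and [A :&: B]. *)
Lemma tight_lattice G x A B : submodular G -> base_polytope G x ->
  mass x A = G A -> mass x B = G B ->
  [/\ gap G A B = 0, mass x (A :|: B) = G (A :|: B)
    & mass x (A :&: B) = G (A :&: B)].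
Proof.
move=> Gs /base_polytopeP[xG _] xA xB.
have := gap_ge0 A B Gs; have := gap_mass x A B.
have := xG (A :|: B); have := xG (A :&: B).
rewrite /gap xA xB; split; lra.
Qed.

(** The sets tight at [greedy G r] form a lattice containing the chain of [r], and
    all its pairs are tight pairs of [G], hence of [G'].  So [G'] minus the mass of
    [greedy G' r] is modular on that lattice and zero on the chain, thus zero. *)
Lemma greedy_tight_transfer G G' r A :
  submodular G -> normalized G -> normalized G' ->
  (forall A B, gap G A B = 0 -> gap G' A B = 0) -> injective r ->
  mass (greedy G r) A = G A -> mass (greedy G' r) A = G' A.
Proof.
move=> Gs G0 G0' GG' rI xA; set x' := greedy G' r.
pose L S := mass (greedy G r) S = G S.
have Gb := greedy_base Gs G0 rI.
have LUI S T : L S -> L T -> L (S :|: T) /\ L (S :&: T).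
  by move=> LS LT; have [] := tight_lattice Gs Gb LS LT.
have Lr k : L (initial r k) by exact: mass_greedy.
have modL S T : L S -> L T -> gap G' S T = 0.
  by move=> LS LT; apply: GG'; have [] := tight_lattice Gs Gb LS LT.
have le1 : 0 <= G' A - mass x' A.
  apply: (ge0_of_initial (h := fun S => G' S - mass x' S) rI LUI Lr) => // [S T LS LT|k].
    by rewrite gapB gap_mass modL // subrr.
  by rewrite mass_greedy // subrr.
have le2 : 0 <= mass x' A - G' A.
  apply: (ge0_of_initial (h := fun S => mass x' S - G' S) rI LUI Lr) => // [S T LS LT|k].
    by rewrite gapB gap_mass modL // subrr.
  by rewrite mass_greedy // subrr.
lra.
Qed.

(** A vector is determined by its masses on the chain of [s], and that chain is
    tight at [greedy G r = greedy G s]. *)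
Lemma greedy_eq_transfer G G' r s :
  submodular G -> normalized G -> normalized G' ->
  (forall A B, gap G A B = 0 -> gap G' A B = 0) -> injective r -> injective s ->
  greedy G r = greedy G s -> greedy G' r = greedy G' s.
Proof.
move=> Gs G0 G0' GG' rI sI rs; apply: (mass_initial_inj sI) => k.
rewrite [RHS]mass_greedy //; apply: (greedy_tight_transfer Gs G0) => //.
by rewrite rs mass_greedy.
Qed.

(** * Orders through prescribed sets *)

Definition height r : nat := (\max_j r j).+1.

(** The order listing first [B] and then its complement, each in the order of [r].
    Its initial segments are the [initial r k :&: B] and the [initial r k :|: B]. *)
Definition frontload B r : 'I_d -> nat :=
  fun i => if i \in B then r i else (height r + r i)%N.

Lemma ltn_height r i : (r i < height r)%N.
Proof. by rewrite ltnS (leq_bigmax i). Qed.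

Lemma frontload_inj B r : injective r -> injective (frontload B r).
Proof.
move=> rI i j; rewrite /frontload; case: ifP => _; case: ifP => _ E; apply: rI => //.
- by have := ltn_height r i; rewrite E ltnNge leq_addr.
- by have := ltn_height r j; rewrite -E ltnNge leq_addr.
- exact: addnI E.
Qed.

Lemma initial_frontloadI B r k : (k <= height r)%N ->
  initial (frontload B r) k = initial r k :&: B.
Proof.
move=> le_k; apply/setP => i; rewrite !inE /frontload.
case: ifP => iB; rewrite ?andbT ?andbF //.
by apply/negbTE; rewrite -leqNgt (leq_trans le_k) // leq_addr.
Qed.

Lemma initial_frontloadU B r k :
  initial (frontload B r) (height r + k) = initial r k :|: B.
Proof.
apply/setP => i; rewrite !inE /frontload.
case: ifP => iB; rewrite ?orbT ?orbF ?ltn_add2l //.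
by rewrite (leq_trans (ltn_height r i)) // leq_addr.
Qed.

(** Bring [A :|: B], then [A], then [A :&: B] to the front of any order: each step
    keeps as initial segments the larger sets obtained before. *)
Lemma initial_chain A B : exists2 r : 'I_d -> nat, injective r &
  [/\ exists k, initial r k = A :&: B, exists k, initial r k = A
    & exists k, initial r k = A :|: B].
Proof.
pose r2 := frontload A (frontload (A :|: B) val).
exists (frontload (A :&: B) r2); first by do 3![apply: frontload_inj]; exact: val_inj.
have r1U : initial (frontload (A :|: B) val) (height val + 0) = A :|: B.
  by rewrite initial_frontloadU initial0 finset.set0U.
have r2U := initial_frontloadU A (frontload (A :|: B) val) (height val + 0).
have r2A := initial_frontloadU A (frontload (A :|: B) val) 0.
rewrite r1U (finset.setUidPl (finset.subsetUl _ _)) in r2U.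
rewrite initial0 finset.set0U in r2A.
split.
- by exists (height r2 + 0)%N; rewrite initial_frontloadU initial0 finset.set0U.
- exists (height r2 + (height (frontload (A :|: B) val) + 0))%N.
  by rewrite initial_frontloadU r2A (finset.setUidPl (finset.subsetIl _ _)).
- exists (height r2 + (height (frontload (A :|: B) val) + (height val + 0)))%N.
  rewrite initial_frontloadU r2U; apply/finset.setUidPl.
  exact: fintype.subset_trans (finset.subsetIl _ _) (finset.subsetUl _ _).
Qed.

(** Take an order [r] whose chain contains [A :&: B], [A] and [A :|: B].  As the
    pair is tight for [G'], the vector [greedy G' r] is also tight at [B]; hence it is
    tight at [initial r k :&: B] and [initial r k :|: B], which make up the chain of
    [frontload B r], and the two orders have the same greedy vector for [G'].  If
    they had the same one for [G], it would be tight at both [A] and [B], forcing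
    [gap G A B = 0]. *)
Lemma gap_lost_greedy_eq G G' A B :
  submodular G -> normalized G -> submodular G' -> normalized G' ->
  gap G A B <> 0 -> gap G' A B = 0 ->
  exists r s, [/\ injective r, injective s, greedy G' r = greedy G' s
    & greedy G r <> greedy G s].
Proof.
move=> Gs G0 Gs' G0' gapG gapG'.
have [r rI [[k1 r1] [k2 r2] [k3 r3]]] := initial_chain A B.
have sI := frontload_inj (B := B) rI.
have r'b := greedy_base Gs' G0' rI.
have tB : mass (greedy G' r) B = G' B.
  have := gap_mass (greedy G' r) A B; move: gapG'.
  rewrite /gap -r1 -r3 !mass_greedy //.
  have := mass_greedy k2 G0' rI; rewrite r2; lra.
exists r, (frontload B r); split => //.
  apply: (mass_initial_inj sI) => k; rewrite [RHS]mass_greedy //.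
  have [le_k|/ltnW/subnKC <-] := leqP k (height r).
    rewrite initial_frontloadI //.
    by have [] := tight_lattice Gs' r'b (mass_greedy k G0' rI) tB.
  rewrite initial_frontloadU.
  by have [] := tight_lattice Gs' r'b (mass_greedy (k - height r) G0' rI) tB.
move=> rs; apply: gapG.
have tA : mass (greedy G r) A = G A by rewrite -r2 mass_greedy.
have tB' : mass (greedy G r) B = G B.
  have := mass_greedy (height r + 0) G0 sI.
  by rewrite initial_frontloadU initial0 finset.set0U -rs.
by have [] := tight_lattice Gs (greedy_base Gs G0 rI) tA tB'.
Qed.

(** The coordinates of a greedy vector are differences of values of [G], so finitely
    many vectors arise although there are infinitely many rank functions. *)
Lemma finite_greedy G (P : set ('I_d -> nat)) : finite_set (greedy G @` P)%classic.
Proof.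
pose f (c : {ffun 'I_d -> {set 'I_d} * {set 'I_d}}) : 'rV[R]_d :=
  \row_i (G (c i).1 - G (c i).2).
apply: (@sub_finite_set _ _ (f @` setT)%classic); last exact/finite_image/finite_finset.
move=> _ [r _ <-].
exists [ffun i => (initial r (r i).+1, initial r (r i))] => //.
by apply/rowP => i; rewrite !mxE ffunE.
Qed.

(** * The vertices of the base polytope *)

(** Abel summation along the chain of [r]. *)
Lemma weighted_mass_ge0 (w : 'I_d -> R) (y : 'rV[R]_d) r : injective r ->
  (forall i j, (r i < r j)%N -> w j <= w i) ->
  (forall k, 0 <= mass y (initial r k)) -> mass y [set: 'I_d] = 0 ->
  0 <= \sum_i w i * y 0 i.
Proof.
move=> rI w_dec y_ge0 y0.
(* The lower bound [m] stands for the weight of the next element of the order;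
   keeping it arbitrary makes the statement inductive. *)
have key k m : (forall i, i \in initial r k -> m <= w i) ->
    m * mass y (initial r k) <= \sum_(i in initial r k) w i * y 0 i.
  elim: k m => [|k IH] m hm; first by rewrite initial0 /mass !big_set0 mulr0.
  have [E|[i ri]] := initialS_or k rI; first by move: hm; rewrite E; apply: IH.
  rewrite -ri in hm IH *; rewrite sum_initialS //.
  have /IH le_i : forall j, j \in initial r (r i) -> w i <= w j.
    by move=> j; rewrite inE; apply: w_dec.
  have le_m : m * mass y (initial r (r i).+1) <= w i * mass y (initial r (r i).+1).
    by rewrite ler_wpM2r // hm // inE.
  by apply: (le_trans le_m); rewrite mass_initialS // mulrDr lerD2l.
have [k rk] := initial_full r; have [m hm] : exists m, forall i, m <= w i.
  by exists (- \sum_i `|w i|) => i; rewrite lerNl (bigD1 i) //=;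
    rewrite (le_trans (ler_norm (- w i))) // normrN lerDl sumr_ge0.
have := key k m (fun i _ => hm i); rewrite rk y0 mulr0.
by under eq_bigl do rewrite finset.in_setT.
Qed.

Lemma decreasing_rank (w : 'I_d -> R) :
  exists2 r : 'I_d -> nat, injective r & forall i j, (r i < r j)%N -> w j <= w i.
Proof.
pose leT i j := w j <= w i; pose s := sort leT (enum 'I_d).
have mem_s i : i \in s by rewrite mem_sort mem_enum.
exists (index^~ s) => [i j|i j ij]; first by apply: index_inj.
have leT_tr : transitive leT by move=> a b c h1 h2; exact: le_trans h2 h1.
apply: (sorted_ltn_index leT_tr) ij => //.
by apply: sort_sorted => a b; exact: le_total.
Qed.

(** If [v] is the unique maximizer of [c], the greedy vector of an order along which
    the weights of [c] decrease also maximizes [c], so it is [v].  Conversely the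
    greedy vector of [r] is the only point of the polytope attaining the bound
    [G (initial r k)] for all [k], hence the unique maximizer of the sum of the
    masses of the initial segments. *)
Lemma vertices_base G : submodular G -> normalized G ->
  vertices (base_polytope G) = (greedy G @` [set r | injective r])%classic.
Proof.
move=> Gs G0; apply/seteqP; split=> [v [c [c0 [c_le vE]]]|_ [r rI <-]].
  have [r rI r_dec] := decreasing_rank (fun i => c 'e_i).
  exists r => //=; have Gb := greedy_base Gs G0 rI.
  have [Bv cv] : ([set x | base_polytope G x /\ c x = c0] v)%classic by rewrite -vE.
  suff : ([set v] (greedy G r))%classic by [].
  rewrite vE; split=> //; apply/eqP; rewrite eq_le c_le //= -cv -subr_ge0 -linearB /=.
  rewrite [X in c X]row_sum_delta linear_sum /=.
  under eq_bigr do rewrite linearZ /= mulrC.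
  have massB S : mass (greedy G r - v) S = mass (greedy G r) S - mass v S.
    by rewrite /mass -sumrB; apply: eq_bigr => i _; rewrite !mxE.
  have /base_polytopeP[vG vT] := Bv.
  apply: (weighted_mass_ge0 rI r_dec) => [k|]; rewrite massB.
    by rewrite mass_greedy // subr_ge0.
  by have /base_polytopeP[_ ->] := Gb; rewrite vT subrr.
have Gb := greedy_base Gs G0 rI.
pose c x := \sum_(k < height r) mass x (initial r k).
have cL : scalar c.
  move=> a x y; rewrite /c mulr_sumr -big_split; apply: eq_bigr => k _ /=.
  by rewrite /mass mulr_sumr -big_split; apply: eq_bigr => i _; rewrite !mxE.
pose cl := GRing.isLinear.Build _ _ _ _ c cL.
pose C : {scalar _} := HB.pack c cl.
have c_le x : base_polytope G x -> c x <= c (greedy G r).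
  move=> /base_polytopeP[xG _]; apply: ler_sum => k _; rewrite mass_greedy //.
exists C, (c (greedy G r)); split=> [x /c_le //|].
apply/seteqP; split=> x /= => [->//|[/base_polytopeP[xG xT] /eqP]].
rewrite eq_sym -subr_eq0 /= /c -sumrB psumr_eq0; last first.
  by move=> k _; rewrite mass_greedy // subr_ge0.
move=> /allP xk; apply: (mass_initial_inj rI) => k.
have [lt_k|le_k] := ltnP k (height r).
  have /implyP/(_ isT) := xk (Ordinal lt_k) (mem_index_enum _).
  by rewrite subr_eq0 => /eqP.
have -> : initial r k = finset.setT.
  by apply/setP => i; rewrite !inE (leq_trans (ltn_height r i)).
by have /base_polytopeP[_ ->] := Gb.
Qed.

End Greedy.

(** * Gaps on classes *)

(** The ratio test: the affine functions [a i + t * b i] are nonnegative at [t = 0],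
    and the first one to vanish, for [t] of either sign, is the one maximizing
    [`|b i| / a i].  Indices with [a i = 0] have [b i = 0] and hence the harmless
    ratio [0 / 0 = 0]. *)
Lemma exists_first_zero (R : realType) (I : finType) (a b : I -> R) :
  (forall i, 0 <= a i) -> (forall i, a i = 0 -> b i = 0) ->
  (exists i, b i <> 0) ->
  exists t, (forall i, 0 <= a i + t * b i) /\
    exists2 i, a i <> 0 & a i + t * b i = 0.
Proof.
move=> a_ge0 ab [i1 bi1].
have [i0 _ ratio_max] := arg_maxP (fun i => `|b i| / a i) (erefl : xpredT i1).
have a_gt0 i : b i <> 0 -> 0 < a i.
  by move=> bi; rewrite lt_def a_ge0 andbT; apply/eqP => /ab.
have bi0 : b i0 <> 0.
  move=> b0; have /= := ratio_max i1 isT; rewrite b0 normr0 mul0r leNgt.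
  by rewrite divr_gt0 ?normr_gt0 ?a_gt0 //; apply/eqP.
have ai0 := a_gt0 _ bi0.
exists (- (a i0 / b i0)); split=> [i|]; last first.
  exists i0; first by move=> a0; rewrite a0 ltxx in ai0.
  by rewrite mulNr divfK ?subrr //; apply/eqP.
have [b0|/eqP bi] := eqVneq (b i) 0; first by rewrite b0 mulr0 addr0.
rewrite mulNr subr_ge0; apply: (le_trans (ler_norm _)).
rewrite !normrM normfV (ger0_norm (ltW ai0)) mulrAC ler_pdivrMr; last first.
  by rewrite normr_gt0; apply/eqP.
have := ratio_max i isT => /=.
by rewrite ler_pdivrMr ?a_gt0 // mulrAC ler_pdivlMr // mulrC [_ * a i]mulrC.
Qed.

Section Classes.
Variables (R : realType) (d : nat).
Local Notation Fbar := (setfun_quot R d).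
Implicit Types (x y K : Fbar) (A B : {set 'I_d}).

Definition class_gap A B x : R := gap (repr x : setfun R d) A B.

Lemma class_gap_cls A B (F : setfun R d) : class_gap A B (cls F) = gap F A B.
Proof.
have /modularP/(_ A B) : repr (cls F) - F \in @modular R d.
  by apply/cls_eq; rewrite cls_repr.
rewrite /class_gap /gap !ffunE; lra.
Qed.

Lemma class_gap_is_scalar A B : scalar (class_gap A B).
Proof.
move=> a x y; rewrite -[x]cls_repr -[y]cls_repr.
have <- : cls (a *: repr x) = a *: cls (repr x) by exact: cls_scale.
by rewrite -clsD !class_gap_cls /gap !ffunE /GRing.scale /=; lra.
Qed.

HB.instance Definition _ A B :=
  GRing.isLinear.Build R Fbar R *%R (class_gap A B) (class_gap_is_scalar A B).

Lemma submod_coneP x : submod_cone x <-> forall A B, 0 <= class_gap A B x.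
Proof.
split=> [[F Fs <-] A B|x_ge0]; first by rewrite class_gap_cls gap_ge0.
exists (repr x); last exact: cls_repr.
apply/forallP => A; apply/forallP => B.
by have := x_ge0 A B; rewrite /class_gap /gap -addrA -opprD subr_ge0.
Qed.

Lemma class_gap_eq0 x : (forall A B, class_gap A B x = 0) -> x = 0.
Proof.
move=> x0; rewrite -[x]cls_repr -[RHS]cls_repr; apply/cls_eq/modularP => A B.
have := x0 A B; have : class_gap A B 0 = 0 by rewrite linear0.
by rewrite /class_gap /gap !ffunE; lra.
Qed.

Lemma norm_repr_submodular x : submod_cone x -> submodular (norm_repr x).
Proof.
move=> /submod_coneP x_ge0; apply/forallP => A; apply/forallP => B.
have := x_ge0 A B; rewrite -{1}[x]cls_norm_repr class_gap_cls.
by rewrite /gap -addrA -opprD subr_ge0.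
Qed.

Lemma fewer_eq_vertices_of_gap x y : submod_cone x -> submod_cone y ->
  (forall A B, class_gap A B x = 0 -> class_gap A B y = 0) ->
  fewer_eq_vertices y x.
Proof.
move=> xs ys xy.
have [nx ny] := (norm_repr_normalized x, norm_repr_normalized y).
have [sx sy] := (norm_repr_submodular xs, norm_repr_submodular ys).
rewrite /fewer_eq_vertices /class_vertices !vertices_base //.
apply: card_image_le_of_factor => r s; apply: greedy_eq_transfer => // A B.
by rewrite -!class_gap_cls !cls_norm_repr; apply: xy.
Qed.

Lemma fewer_vertices_of_gap x y A B : submod_cone x -> submod_cone y ->
  (forall A B, class_gap A B x = 0 -> class_gap A B y = 0) ->
  class_gap A B x <> 0 -> class_gap A B y = 0 -> fewer_vertices y x.
Proof.
move=> xs ys xy xAB yAB; split; first exact: fewer_eq_vertices_of_gap.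
have [nx ny] := (norm_repr_normalized x, norm_repr_normalized y).
have [sx sy] := (norm_repr_submodular xs, norm_repr_submodular ys).
rewrite -[x]cls_norm_repr class_gap_cls in xAB.
rewrite -[y]cls_norm_repr class_gap_cls in yAB.
have [r [s [rI sI rs_y rs_x]]] := gap_lost_greedy_eq sx nx sy ny xAB yAB.
rewrite /fewer_eq_vertices /class_vertices !vertices_base //.
apply: (card_image_ltN _ (finite_greedy _ _) rI sI rs_y rs_x) => r' s'.
apply: greedy_eq_transfer => // A' B'.
by rewrite -!class_gap_cls !cls_norm_repr; apply: xy.
Qed.

(** * Minimal decompositions *)

(** If [K] were nonzero, moving along it until a new pair becomes tight for one of
    the two functions would give a decomposition with fewer vertices. *)
Lemma minimal_decomposition_rigid F G H K : minimal_decomposition F (G, H) ->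
  (forall A B, class_gap A B G = 0 -> class_gap A B K = 0) ->
  (forall A B, class_gap A B H = 0 -> class_gap A B K = 0) -> K = 0.
Proof.
move=> [[/= Gs Hs FE] min] GK HK; apply: contrapT => K0; apply: min.
(* The boolean selects which of the two functions the gap is taken of. *)
pose a (i : bool * ({set 'I_d} * {set 'I_d})) :=
  class_gap i.2.1 i.2.2 (if i.1 then G else H).
pose b (i : bool * ({set 'I_d} * {set 'I_d})) := class_gap i.2.1 i.2.2 K.
have a_ge0 i : 0 <= a i.
  case: i => -[] [A B]; [exact: (submod_coneP G).1 | exact: (submod_coneP H).1].
have ab i : a i = 0 -> b i = 0 by case: i => -[] [A B]; [apply: GK | apply: HK].
have [|t [abt [[e [A B]] /= ai abi]]] := exists_first_zero a_ge0 ab.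
  apply: contrapT => b0; apply: K0; apply: class_gap_eq0 => A B.
  by apply: contrapT => KAB; apply: b0; exists (true, (A, B)).
have gapD C D x : class_gap C D (x + t *: K) = class_gap C D x + t * class_gap C D K.
  by rewrite linearD linearZ.
have Gs' : submod_cone (G + t *: K).
  by apply/submod_coneP => C D; rewrite gapD; apply: (abt (true, (C, D))).
have Hs' : submod_cone (H + t *: K).
  by apply/submod_coneP => C D; rewrite gapD; apply: (abt (false, (C, D))).
have GG' C D : class_gap C D G = 0 -> class_gap C D (G + t *: K) = 0.
  by move=> GCD; rewrite gapD GCD GK // mulr0 addr0.
have HH' C D : class_gap C D H = 0 -> class_gap C D (H + t *: K) = 0.
  by move=> HCD; rewrite gapD HCD HK // mulr0 addr0.
exists (G + t *: K, H + t *: K); split=> /=.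
- by split=> //=; rewrite FE opprD addrACA subrr addr0.
- case=> EG EH; apply: ai; rewrite -abi /a /b /=.
  by case: e {abi} => /=; rewrite -gapD ?EG ?EH.
- exact: fewer_eq_vertices_of_gap.
- exact: fewer_eq_vertices_of_gap.
- move: ai abi; rewrite /a /b /=; case: e => /=; rewrite -gapD => ai abi.
    by left; apply: fewer_vertices_of_gap ai abi.
  by right; apply: fewer_vertices_of_gap ai abi.
Qed.

Definition neg_tight_gaps (G H : Fbar) (gh : Fbar * Fbar) : R := - (
  \sum_(p : {set 'I_d} * {set 'I_d} | class_gap p.1 p.2 G == 0) class_gap p.1 p.2 gh.1 +
  \sum_(p : {set 'I_d} * {set 'I_d} | class_gap p.1 p.2 H == 0) class_gap p.1 p.2 gh.2).

Lemma neg_tight_gaps_is_scalar G H : scalar (neg_tight_gaps G H).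
Proof.
move=> a u v; rewrite /neg_tight_gaps /=.
have lin (P : pred ({set 'I_d} * {set 'I_d})) x y :
    \sum_(p | P p) class_gap p.1 p.2 (a *: x + y) =
    a * (\sum_(p | P p) class_gap p.1 p.2 x) + \sum_(p | P p) class_gap p.1 p.2 y.
  by rewrite mulr_sumr -big_split; apply: eq_bigr => p _; rewrite linearD linearZ.
by rewrite !lin; lra.
Qed.

HB.instance Definition _ G H := GRing.isLinear.Build R (Fbar * Fbar)%type R *%R
  (neg_tight_gaps G H) (neg_tight_gaps_is_scalar G H).

End Classes.

Theorem corollary7p13 (R : realType) (d : nat)
  (F G H : setfun_quot R d) :
  minimal_decomposition F (G, H) -> is_vertex (decompositions F) (G, H).
Proof.
move=> minGH; have [[/= Gs Hs FE] _] := minGH.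
exists (neg_tight_gaps G H), 0.
have gh_ge0 gh : decompositions F gh ->
    (forall p : {set 'I_d} * {set 'I_d}, 0 <= class_gap p.1 p.2 gh.1) /\
    (forall p : {set 'I_d} * {set 'I_d}, 0 <= class_gap p.1 p.2 gh.2).
  by move=> [/submod_coneP gs /submod_coneP hs _].
split=> [gh /gh_ge0[g_ge0 h_ge0]|].
  by rewrite /= oppr_le0 addr_ge0 // sumr_ge0.
apply/seteqP; split=> [_ ->|[G' H'] [GH' /eqP]].
  by split=> //=; rewrite /neg_tight_gaps /= !big1 ?addr0 ?oppr0 // => p /eqP.
have [/= g_ge0 h_ge0] := gh_ge0 _ GH'; have [/= _ _ FE'] := GH'.
rewrite oppr_eq0 paddr_eq0 ?sumr_ge0 // !psumr_eq0 // => /andP[/allP G0 /allP H0].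
have HK : H' - H = G' - G.
  have -> : G' = G - H + H' by rewrite -FE FE' subrK.
  by rewrite addrAC (addrAC G) subrr add0r addrC.
have K0 : G' - G = 0.
  apply: (minimal_decomposition_rigid minGH) => A B gap0.
    have /implyP := G0 (A, B) (mem_index_enum _).
    by rewrite /= gap0 eqxx linearB /= gap0 subr0 => /(_ isT)/eqP.
  have /implyP := H0 (A, B) (mem_index_enum _).
  by rewrite -HK /= gap0 eqxx linearB /= gap0 subr0 => /(_ isT)/eqP.
by move/subr0_eq: (K0) => ->; move: K0; rewrite -HK => /subr0_eq ->.
Qed.
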